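(* Let $\mathfrak{S} = \{\mathcal{S}_{\boldsymbol{\theta},\mathcal{B}} \mid \boldsymbol{\theta} \in \Theta,\ \mathcal{B} \in \mathbb{B}\}$ be the family of solution operators $\mathcal{S}_{\boldsymbol{\theta},\mathcal{B}} : \mathcal{X}_{\mathrm{init}} \to \mathcal{Y}$ of the parametric boundary value problem described in the context, under the existence, uniqueness and non-degeneracy assumptions stated there. Then a single-valued operator $\mathcal{M}_{\phi} : \mathcal{X}_{\mathrm{init}} \to \mathcal{Y}$ defined solely on the initial condition space cannot universally represent the family $\mathfrak{S}$. For the Generalized Neural Operator to be well-defined as a function approximating $\mathfrak{S}$, its domain must be augmented to include the parameter space $\Theta$ and the boundary operator space $\mathbb{B}$.
   Context: Setting. Let $\Omega \subseteq \mathbb{R}^d$ be a bounded domain with boundary $\partial\Omega$. For parameters $\boldsymbol{\theta} \in \Theta \subseteq \mathbb{R}^p$, let $\mathcal{L}_{\boldsymbol{\theta}}$ be a parameterized differential operator whose structural form is fixed. Let $\mathcal{B} \in \mathbb{B}$ be a boundary operator, which specifies the type of boundary constraint and the associated boundary data; $\mathbb{B}$ is the set of admissible boundary operators. The parametric boundary value problem with initial condition $\boldsymbol{u}_0$ is $$\frac{\partial \boldsymbol{u}}{\partial t} + \mathcal{L}_{\boldsymbol{\theta}}[\boldsymbol{u}] = 0 \ \text{ for } (\boldsymbol{x},t) \in \Omega \times (0,T], \qquad \mathcal{B}[\boldsymbol{u}] = 0, \qquad \boldsymbol{u}(\boldsymbol{x},0) = \boldsymbol{u}_0(\boldsymbol{x})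 \ \text{ for } \boldsymbol{x} \in \Omega .$$ $\mathcal{X}_{\mathrm{init}}$ is the topological vector space of initial conditions and $\mathcal{Y}$ is the topological vector space of solution trajectories. For fixed $(\boldsymbol{\theta},\mathcal{B})$, the solution operator $\mathcal{S}_{\boldsymbol{\theta},\mathcal{B}} : \mathcal{X}_{\mathrm{init}} \to \mathcal{Y}$ maps $\boldsymbol{u}_0$ to the solution trajectory $\boldsymbol{u}$ of this problem. Write $\mathcal{C} = \Theta \times \mathbb{B}$ for the configuration space and $\mathcal{S}_c = \mathcal{S}_{\boldsymbol{\theta},\mathcal{B}}$ for $c = (\boldsymbol{\theta},\mathcal{B}) \in \mathcal{C}$. The Generalized Neural Operator is a neural operator $\mathcal{M}_{\phi}$, with parameters $\phi$, that is to approximate the family of operators in $\mathfrak{S}$. An operator $\mathcal{M}_{\phi} : \mathcal{X}_{\mathrm{init}} \to \mathcal{Y}$ depending only on the initial condition represents the family $\mathfrak{S}$ if $\mathcal{M}_{\phi}(\boldsymbol{u}_0) = \mathcal{S}_c(\boldsymbol{u}_0)$ for every configuration $c \in \mathcal{C}$ and every initial condition $\boldsymbol{u}_0$. Assumptions. - Existence: for every initial condition $\boldsymbol{u}_0 \in \mathcal{X}_{\mathrm{init}}$, a solution $\boldsymbol{u} \in \mathcal{Y}$ to the problem above exists. - Uniqueness: the solution to the problem is locally unique; specifically, for a fixed initial condition $\boldsymbol{u}_0$ there exists exactly one solution trajectory $\boldsymbol{u}$, so that $\mathcal{S}_{\boldsymbol{\theta},\mathcal{B}}$ is a single-valued mapping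 rather than a one-to-many relation. - Non-degeneracy: the family of PDE problems defined by $\mathcal{C}$ is non-degenerate, i.e. the PDE parameters and boundary conditions exert a non-trivial influence on the system dynamics: if an initial condition $\boldsymbol{u}_0$ sufficiently excites the system (a phrase left informal), then there exist at least two distinct configurations $c_1, c_2 \in \mathcal{C}$, $c_1 \neq c_2$, such that $\mathcal{S}_{c_1}(\boldsymbol{u}_0) \neq \mathcal{S}_{c_2}(\boldsymbol{u}_0)$.
   Formalization: At least one initial condition is assumed to sufficiently excite the system; Θ and 𝔹 are not each shown necessary: the input must separate configurations with different solutions, and either factor can be omitted exactly when solutions do not depend on it. *)

(* Defs.v *)
From HB Require Import structures.
Set Warnings "-notation-overridden,-notation-incompatible-prefix,-ambiguous-paths".
From mathcomp Require Import all_boot all_order all_algebra.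
From mathcomp Require Import all_classical all_reals all_analysis.

Set Implicit Arguments.
Unset Strict Implicit.
Unset Printing Implicit Defensive.

Import Order.TTheory GRing.Theory Num.Theory.
Import numFieldNormedType.Exports.

Local Open Scope classical_set_scope.
Local Open Scope ring_scope.

Section Calculus.
Context {R : realType} {d m : nat}.

Definition domain (A : set 'rV[R]_d) : Prop :=
  [/\ A !=set0, open A & connected A].

Definition boundary (A : set 'rV[R]_d) : set 'rV[R]_d :=
  closure A `\` interior A.

(* [partials [:: i1; ...; ik] f] is the iterated partial derivative
   d_i1 (... (d_ik f)); it is meaningful only where [partially_derivable]. *)
Definition partials (s : seq 'I_d) (f : 'rV[R]_d -> 'rV[R]_m) :
    'rV[R]_d -> 'rV[R]_m :=
  foldr (fun i g x => 'D_('e_i) g x) f s.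

Definition partially_derivable (k : nat) (A : set 'rV[R]_d)
    (f : 'rV[R]_d -> 'rV[R]_m) : Prop :=
  forall (s : seq 'I_d) (i : 'I_d) (x : 'rV[R]_d),
    (size s < k)%N -> A x -> derivable (partials s f) x 'e_i.

(* The derivative is taken within [0, T], so that it is one-sided at t = T and
   never looks at times at which the trajectory is not defined. *)
Definition has_time_derivative (T : R) (f : R -> 'rV[R]_m) (t : R)
    (l : 'rV[R]_m) : Prop :=
  (fun s => (s - t)^-1 *: (f s - f t)) @ within `[0, T] t^' --> l.

End Calculus.

(* X and Y are abstract topological vector spaces; their elements are read as
   functions through linear maps [init_val] and [traj_val], injective up to the
   values on Omega and on closure Omega * [0, T] respectively.
   The operator L_theta is a (possibly nonlinear) spatial differential operator
   of order at most [order]: a fixed function [structural_form] of theta, of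
   the point, and of the partial derivatives up to that order.
   A boundary operator is any map from trajectories to R^q-valued functions on
   boundary Omega * (0, T], which allows for nonlocal (e.g. periodic)
   conditions and for any kind of trace. *)
Record parametric_bvp (R : realType) (d m p q : nat)
    (X Y : topologicalLmodType R) := ParametricBVP {
  Omega : set 'rV[R]_d;
  Omega_domain : domain Omega;
  Omega_bounded : bounded_set Omega;
  horizon : R;
  horizon_gt0 : 0 < horizon;
  init_val : {linear X -> ('rV[R]_d -> 'rV[R]_m)};
  init_val_inj : forall u0 v0 : X,
    (forall x, Omega x -> init_val u0 x = init_val v0 x) -> u0 = v0;
  traj_val : {linear Y -> ('rV[R]_d -> R -> 'rV[R]_m)};
  traj_val_inj : forall u v : Y,
    (forall x t, closure Omega x -> 0 <= t <= horizon ->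
       traj_val u x t = traj_val v x t) -> u = v;
  Theta : set 'rV[R]_p;
  order : nat;
  structural_form : 'rV[R]_p -> 'rV[R]_d -> R ->
    (order.-bseq 'I_d -> 'rV[R]_m) -> 'rV[R]_m;
  boundary_ops : set (Y -> 'rV[R]_d -> R -> 'rV[R]_q)
}.

Arguments structural_form {R d m p q X Y} _ _ _ _ _.

Section SolutionOperators.
Context {R : realType} {d m p q : nat} {X Y : topologicalLmodType R}.
Variable P : parametric_bvp d m p q X Y.

Definition configuration : Type := (Theta P * boundary_ops P)%type.

Definition diff_op (theta : 'rV[R]_p) (u : 'rV[R]_d -> R -> 'rV[R]_m)
    (x : 'rV[R]_d) (t : R) : 'rV[R]_m :=
  structural_form P theta x t
    (fun s : (order P).-bseq 'I_d => partials s (u^~ t) x).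

Definition solves (c : configuration) (u0 : X) (u : Y) : Prop :=
  let v := traj_val P u in
  [/\ forall t, 0 < t <= horizon P ->
        partially_derivable (order P) (Omega P) (v^~ t),
      forall x t, Omega P x -> 0 < t <= horizon P ->
        exists2 dv, has_time_derivative (horizon P) (v x) t dv &
                    dv + diff_op (val c.1) v x t = 0,
      forall x t, boundary (Omega P) x -> 0 < t <= horizon P ->
        val c.2 u x t = 0 &
      forall x, Omega P x -> v x 0 = init_val P u0 x].

Definition solution_exists : Prop :=
  forall (c : configuration) (u0 : X), exists u : Y, solves c u0 u.

Definition solution_unique : Prop :=
  forall (c : configuration) (u0 : X) (u v : Y),
    solves c u0 u -> solves c u0 v -> u = v.

(* The trajectory solving the problem; the default value 0 plays no role under
   [solution_exists]. *)
Definition solution_operator (c : configuration) (u0 : X) : Y :=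
  xget 0 [set u | solves c u0 u].

Lemma solution_operatorP : solution_exists -> solution_unique ->
  forall c u0 u, solves c u0 u <-> u = solution_operator c u0.
Proof.
move=> ex un c u0 u; have S_sol : solves c u0 (solution_operator c u0).
  exact: (xgetPex 0 (ex c u0)).
by split=> [u_sol|-> //]; exact: un u_sol S_sol.
Qed.

(* [excites] stands for the informal "u0 sufficiently excites the system". *)
Definition nondegenerate_family (excites : set X) : Prop :=
  forall u0, excites u0 -> exists c1 c2 : configuration,
    c1 <> c2 /\ solution_operator c1 u0 <> solution_operator c2 u0.

Definition represents (M : X -> Y) : Prop :=
  forall (c : configuration) (u0 : X), M u0 = solution_operator c u0.

(* The same notion for an operator on another input space D, where [input]
   says what part of (u0, theta, B) the operator is given. *)
Definition represents_on (D : Type)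
    (input : X -> Theta P -> boundary_ops P -> D) (M : D -> Y) : Prop :=
  forall (c : configuration) (u0 : X),
    M (input u0 c.1 c.2) = solution_operator c u0.

End SolutionOperators.

Arguments represents_on {R d m p q X Y} P {D} input M.

(* Main.v *)
(** A family of maps factors through an input exactly when it is constant on
    the fibres of that input. Non-degeneracy puts two configurations with
    distinct solutions in one fibre of the projection to the initial
    condition. *)

Require Import Defs.
From HB Require Import structures.
Set Warnings "-notation-overridden,-notation-incompatible-prefix,-ambiguous-paths".
From mathcomp Require Import all_boot all_order all_algebra.
From mathcomp Require Import all_classical all_reals all_analysis.

Set Implicit Arguments.
Unset Strict Implicit.
Unset Printing Implicit Defensive.

Import Order.TTheory GRing.Theory Num.Theory.
Import numFieldNormedType.Exports.

Local Open Scope classical_set_scope.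
Local Open Scope ring_scope.

Lemma ex_represents_onP (R : realType) (d m p q : nat)
    (X Y : topologicalLmodType R) (P : parametric_bvp d m p q X Y)
    (D : Type) (input : X -> Theta P -> boundary_ops P -> D) :
  (exists M, represents_on P input M) <->
  (forall (c1 c2 : configuration P) (u0 v0 : X),
     input u0 c1.1 c1.2 = input v0 c2.1 c2.2 ->
     solution_operator c1 u0 = solution_operator c2 v0).
Proof.
split=> [[M repM] c1 c2 u0 v0 eq_in|const_fib].
  by rewrite -repM eq_in repM.
pose fibre z := [set y : Y | exists (c : configuration P) (u0 : X),
  input u0 c.1 c.2 = z /\ solution_operator c u0 = y].
(* Any value attained on the fibre will do, since constancy makes it the only one; the default 0 is
   taken only off the range of [input]. *)
exists (fun z => xget 0 (fibre z)) => c u0.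
have : fibre (input u0 c.1 c.2) (solution_operator c u0) by exists c, u0.
by move=> /(xgetI 0)[c' [v0 [eq_in <-]]]; exact: const_fib.
Qed.

Theorem proposition4p1 (R : realType) (d m p q : nat)
    (X Y : topologicalLmodType R) (P : parametric_bvp d m p q X Y)
    (excites : set X)
    (hexists : solution_exists P) (hunique : solution_unique P)
    (hnondeg : nondegenerate_family P excites) (hexc : exists u0, excites u0) :
  [/\ (* no operator on the initial conditions alone represents the family *)
      forall (Phi : Type) (M : Phi -> X -> Y) (phi : Phi),
        ~ represents P (M phi),
      (* on the augmented domain the family is a well-defined operator *)
      exists M : X * Theta P * boundary_ops P -> Y,
        [/\ represents_on P (fun u0 theta B => (u0, theta, B)) M,
            forall M', represents_on P (fun u0 theta B => (u0, theta, B)) M' ->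
              M' = M &
            forall u0 (theta : Theta P) (B : boundary_ops P),
              solves (theta, B) u0 (M (u0, theta, B))],
      (* any input on which the family is well defined separates the
         configurations that have different solutions; in particular it is
         not a function of the initial condition alone *)
      forall (D : Type) (input : X -> Theta P -> boundary_ops P -> D)
          (M : D -> Y), represents_on P input M ->
        (forall u0 (c1 c2 : configuration P),
           solution_operator c1 u0 <> solution_operator c2 u0 ->
           input u0 c1.1 c1.2 <> input u0 c2.1 c2.2) /\
        (forall u0, excites u0 -> exists c1 c2 : configuration P,
           c1 <> c2 /\ input u0 c1.1 c1.2 <> input u0 c2.1 c2.2),
      (* the boundary operator can be left out of the input exactly when the
         solutions do not depend on it *)
      (exists M, represents_on P (fun u0 theta _ => (u0, theta)) M) <->
        (forall u0 (theta : Theta P) (B1 B2 : boundary_ops P),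
           solution_operator (theta, B1) u0 =
           solution_operator (theta, B2) u0) &
      (* likewise for the parameter *)
      (exists M, represents_on P (fun u0 _ B => (u0, B)) M) <->
        (forall u0 (theta1 theta2 : Theta P) (B : boundary_ops P),
           solution_operator (theta1, B) u0 =
           solution_operator (theta2, B) u0)].
Proof.
have separates (D : Type) (input : X -> Theta P -> boundary_ops P -> D) M :
    represents_on P input M -> forall u0 (c1 c2 : configuration P),
    solution_operator c1 u0 <> solution_operator c2 u0 ->
    input u0 c1.1 c1.2 <> input u0 c2.1 c2.2.
  move=> repM u0 c1 c2 neq_S eq_in; apply: neq_S.
  by rewrite -!repM eq_in.
split.
- move=> Phi M phi repM; have [u0 /hnondeg[c1 [c2 [_]]]] := hexc.
  by rewrite -!repM.
- exists (fun z => solution_operator (z.1.2, z.2) z.1.1); split.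
  + by case=> theta B u0.
  (* Every triple is the input of some configuration and initial condition, so the operator is fixed
     pointwise. *)
  + move=> M' repM'; apply/funext => -[[u0 theta] B].
    exact: (repM' (theta, B) u0).
  + by move=> u0 theta B; exact/(solution_operatorP hexists hunique).
- move=> D input M repM; split; first exact: separates repM.
  move=> u0 /hnondeg[c1 [c2 [neq_c neq_S]]].
  by exists c1, c2; split; last exact: separates repM _ _ _ neq_S.
(* Equal inputs share the initial condition and [theta], so a fibre varies only in the boundary
   operator. *)
- rewrite ex_represents_onP; split=> [const_fib u0 theta B1 B2|indep].
    exact: const_fib.
  by move=> [theta1 B1] [theta2 B2] u0 v0 /= [-> ->].
- rewrite ex_represents_onP; split=> [const_fib u0 theta1 theta2 B|indep].
    exact: const_fib.
  by move=> [theta1 B1] [theta2 B2] u0 v0 /= [-> ->].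
Qed.
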